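(* Let $A$ be a $\Bbbk$-algebra, $M$ a submonoid of a group $G$, and suppose $\rho:G\to\operatorname{Aut}(A)$ is a group homomorphism such that $\operatorname{im}(\rho|_M)\cap\operatorname{Inn}(A)=\{\mathrm{id}_A\}$ and $H:=\ker\rho\cap M\subseteq C(M)$. Set $T=A\otimes_\tau\Bbbk M$, and suppose $R$ is a central subalgebra of $T$ such that: (a) $A$ is free over $A\cap R$ of rank $n<\infty$; (b) $R=(A\cap R)\otimes\Bbbk H$; and (c) there exists a basis $\{m_1,\dots,m_\ell\}$ of $\Bbbk M$ over $\Bbbk H$ with $m_1=e_M$ and all $m_i\in M$. Then $$d(T/R)=_{R^\times}\bigl(d(A/A\cap R)\bigr)^{\ell}\,\bigl(d(\Bbbk M/\Bbbk H)\bigr)^{n}.$$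
   Context: $\Bbbk$ is an algebraically closed field of characteristic zero; all algebras are (unital associative, not necessarily commutative) $\Bbbk$-algebras and unadorned tensor products are over $\Bbbk$. $\operatorname{Inn}(A)$ is the set of inner automorphisms of $A$, where $\sigma\in\operatorname{Aut}(A)$ is called inner if there exists a nonzero $a\in A$ such that $xa=a\sigma(x)$ for all $x\in A$. $C(M)$ is the center of the monoid $M$, $e_M$ its identity, $\Bbbk M$ its monoid algebra. For $m\in M$, $a\in A$ write $ma=\rho(m)(a)$. $A\otimes_\tau\Bbbk M$ is the twisted tensor product: the vector space $A\otimes\Bbbk M$ with multiplication determined by $(a\otimes m)(b\otimes m')=a(mb)\otimes mm'$. $A$, $\Bbbk M$ and $M$ are identified with their images in $A\otimes_\tau\Bbbk M$ under the canonical embeddings $a\mapsto a\otimes e_M$, $m\mapsto 1\otimes m$; thus $A\cap R$ is taken inside $T$. Discriminant: if $P$ is an algebra that is finitely generated free of rank $N$ over a central subalgebra $Q\subseteq C(P)$, left multiplication gives an embedding $P\to\operatorname{End}_Q(P)\cong M_N(Q)$, and $\operatorname{tr}:P\to Q$ is its composition with the matrix trace. For a $Q$-basis $\{z_1,\dots,z_N\}$ of $P$, $d(P/Q)=\det(\operatorname{tr}(z_iz_j))_{i,j}\in Q$; it is well defined up to multiplication by units of $Q$. The notation $x=_{Q^\times}y$ means $x=cy$ for some unit $c\in Q^\times$. ($T$ is free over $R$ with basis $\{x_i\otimes m_j\}$ for any basis $\{x_i\}$ of $A$ over $A\cap R$.) *)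

(* Defs.v *)
From HB Require Import structures.
From mathcomp Require Import all_boot all_algebra.
From mathcomp Require Import finmap.
From mathcomp Require Import boolp.
From mathcomp.multinomials Require Import monalg.

Set Implicit Arguments.
Unset Strict Implicit.
Unset Printing Implicit Defensive.

Import GRing.Theory.

Local Open Scope fset_scope.
Local Open Scope ring_scope.

Definition is_alg_aut (k : comNzRingType) (A : algType k) (f : A -> A) : Prop :=
  [/\ linear f, {morph f : x y / x * y}, f 1 = 1 & bijective f].

(* Aut(A): the group of k-algebra automorphisms of A under composition.       *)
Record algAut (k : comNzRingType) (A : algType k) := AlgAut {
  alg_aut_fun :> A -> A;
  alg_autP : `[< is_alg_aut alg_aut_fun >] }.

HB.instance Definition _ (k : comNzRingType) (A : algType k) :=
  [isSub for @alg_aut_fun k A].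
HB.instance Definition _ (k : comNzRingType) (A : algType k) :=
  [Choice of algAut A by <:].

Section AlgAut.
Context {k : comNzRingType} {A : algType k}.
Implicit Types f g h : algAut A.

Lemma alg_aut_isP f : is_alg_aut f.
Proof. exact/asboolP/alg_autP. Qed.

Lemma algAut_eqP f g : f =1 g -> f = g.
Proof. by move=> e; apply/val_inj/funext. Qed.

Fact aut_one_subproof : `[< is_alg_aut (@id A) >].
Proof. by apply/asboolP; split=> //; exists id. Qed.

Fact aut_mul_subproof f g : `[< is_alg_aut (f \o g) >].
Proof.
have [fl fM f1 fb] := alg_aut_isP f; have [gl gM g1 gb] := alg_aut_isP g.
apply/asboolP; split=> /= [a x y|x y||]; last exact: bij_comp.
- by rewrite /= gl fl.
- by rewrite /= gM fM.
- by rewrite /= g1 f1.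
Qed.

Fact aut_inv_ex f : {g : A -> A | cancel f g /\ cancel g f}.
Proof.
apply: cid; have [_ _ _ [g fK gK]] := alg_aut_isP f; by exists g.
Qed.

Fact aut_inv_subproof f : `[< is_alg_aut (sval (aut_inv_ex f)) >].
Proof.
have [fl fM f1 _] := alg_aut_isP f.
case: (aut_inv_ex f) => g /= [fK gK]; apply/asboolP; split.
- by move=> a x y; apply: (can_inj fK); rewrite fl !gK.
- by move=> x y; apply: (can_inj fK); rewrite fM !gK.
- by apply: (can_inj fK); rewrite gK f1.
- by exists f.
Qed.

Definition aut_one := AlgAut aut_one_subproof.
Definition aut_mul f g := AlgAut (aut_mul_subproof f g).
Definition aut_inv f := AlgAut (aut_inv_subproof f).

Fact aut_mulA : associative aut_mul.
Proof. by move=> f g h; apply: algAut_eqP. Qed.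
Fact aut_mul1g : left_id aut_one aut_mul.
Proof. by move=> f; apply: algAut_eqP. Qed.
Fact aut_mulg1 : right_id aut_one aut_mul.
Proof. by move=> f; apply: algAut_eqP. Qed.
Fact aut_mulVg : left_inverse aut_one aut_inv aut_mul.
Proof.
by move=> f; apply: algAut_eqP => x /=; case: (aut_inv_ex f) => g /= [].
Qed.
Fact aut_mulgV : right_inverse aut_one aut_inv aut_mul.
Proof.
by move=> f; apply: algAut_eqP => x /=; case: (aut_inv_ex f) => g /= [].
Qed.

HB.instance Definition _ := isGroup.Build (algAut A)
  aut_mulA aut_mul1g aut_mulg1 aut_mulVg aut_mulgV.

Lemma aut1E x : (1%g : algAut A) x = x. Proof. by []. Qed.
Lemma autME f g x : (f * g)%g x = f (g x). Proof. by []. Qed.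

HB.instance Definition _ f := GRing.isLinear.Build k A A *:%R f
  (let: And4 H _ _ _ := alg_aut_isP f in H).
HB.instance Definition _ f := GRing.isMonoidMorphism.Build A A f
  (let: And4 _ HM H1 _ := alg_aut_isP f in (H1, HM)).

End AlgAut.

Definition inner (k : comNzRingType) (A : algType k) (s : algAut A) : Prop :=
  exists2 a : A, a != 0 & forall x, x * a = a * s x.

(* A (x)_tau kM.  As M is a k-basis of kM, the vector space A (x) kM is the   *)
(* space of finitely supported functions M -> A, where a (x) m is the         *)
(* function << a *g m >> with value a at m and 0 elsewhere; see [tens] below  *)
(* for a (x) x with x in kM.                                                  *)
Definition twisted (k : comNzRingType) (A : algType k) (M : monoidType)
  (act : UMagmaMorphism.type M (algAut A)) : Type := {malg A[M]}.

Section Twisted.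
Context {k : comNzRingType} {A : algType k} {M : monoidType}.
Context (act : UMagmaMorphism.type M (algAut A)).

Local Notation T := (twisted act).
Implicit Types (g : T) (m : M) (a : A) (c : k).

HB.instance Definition _ := GRing.Zmodule.on T.

Let act1 a : act 1%g a = a. Proof. by rewrite gmulf1. Qed.
Let actM m m' a : act (m * m')%g a = act m (act m' a).
Proof. by rewrite gmulfM. Qed.

Definition twscale c g : T := [malg m in msupp g => c *: g@_m].

Lemma twscaleE c g m : (twscale c g)@_m = c *: g@_m.
Proof. by rewrite mcoeffE; case: msuppP; rewrite ?scaler0. Qed.

Fact twscaleA c1 c2 g : twscale c1 (twscale c2 g) = twscale (c1 * c2) g.
Proof. by apply/malgP=> m; rewrite !twscaleE scalerA. Qed.
Fact twscale1 : left_id 1 twscale.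
Proof. by move=> g; apply/malgP=> m; rewrite !twscaleE scale1r. Qed.
Fact twscaleDr : right_distributive twscale +%R.
Proof. by move=> c g1 g2; apply/malgP=> m; rewrite !(mcoeffD, twscaleE) scalerDr. Qed.
Fact twscaleDl g : {morph twscale^~ g : c1 c2 / c1 + c2}.
Proof. by move=> c1 c2; apply/malgP=> m; rewrite !(mcoeffD, twscaleE) scalerDl. Qed.

HB.instance Definition _ := GRing.Zmodule_isLmodule.Build k T
  twscaleA twscale1 twscaleDr twscaleDl.

Definition twone : T := << 1 *g 1%g >>.

Definition twmul g1 g2 : T :=
  \sum_(m1 <- msupp g1) \sum_(m2 <- msupp g2)
    << g1@_m1 * act m1 g2@_m2 *g (m1 * m2)%g >>.

Let twmulw (d1 d2 : {fset M}) g1 g2 :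
  msupp g1 `<=` d1 -> msupp g2 `<=` d2 ->
  twmul g1 g2 = \sum_(m1 <- d1) \sum_(m2 <- d2)
    << g1@_m1 * act m1 g2@_m2 *g (m1 * m2)%g >>.
Proof.
move=> le1 le2; rewrite /twmul (big_fset_incl _ le1) /=.
  apply/eq_bigr=> m1 _; apply/big_fset_incl => // m _ /mcoeff_outdom ->.
  by rewrite raddf0 mulr0 monalgU0.
move=> m _ /mcoeff_outdom g1m.
by rewrite big1 => // m' _; rewrite g1m mul0r monalgU0.
Qed.

Lemma twmulUU a1 a2 m1 m2 :
  twmul << a1 *g m1 >> << a2 *g m2 >> = << a1 * act m1 a2 *g (m1 * m2)%g >>.
Proof. by rewrite (twmulw msuppU_le msuppU_le) !big_seq_fset1 !mcoeffUU. Qed.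

Fact twmulDl : left_distributive twmul +%R.
Proof.
move=> g1 g2 g.
rewrite (twmulw (msuppD_le g1 g2) (fsubset_refl _)).
rewrite (twmulw (fsubsetUl _ (msupp g2)) (fsubset_refl (msupp g))).
rewrite (twmulw (fsubsetUr (msupp g1) _) (fsubset_refl (msupp g))).
rewrite -big_split /=; apply/eq_bigr=> m1 _.
rewrite -big_split /=; apply/eq_bigr=> m2 _.
by rewrite mcoeffD mulrDl monalgUD.
Qed.

Fact twmulDr : right_distributive twmul +%R.
Proof.
move=> g g1 g2.
rewrite (twmulw (fsubset_refl _) (msuppD_le g1 g2)).
rewrite (twmulw (fsubset_refl (msupp g)) (fsubsetUl _ (msupp g2))).
rewrite (twmulw (fsubset_refl (msupp g)) (fsubsetUr (msupp g1) _)).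
rewrite -big_split /=; apply/eq_bigr=> m1 _.
rewrite -big_split /=; apply/eq_bigr=> m2 _.
by rewrite mcoeffD raddfD mulrDr monalgUD.
Qed.

Let twmul0g g : twmul 0 g = 0.
Proof. by rewrite /twmul msupp0 big_seq_fset0. Qed.
Let twmulg0 g : twmul g 0 = 0.
Proof.
by rewrite /twmul big1 // => m _; rewrite msupp0 big_seq_fset0.
Qed.

Let twmul_suml I (r : seq I) (F : I -> T) g :
  twmul (\sum_(i <- r) F i) g = \sum_(i <- r) twmul (F i) g.
Proof. exact: (big_morph (twmul^~ g) (fun _ _ => twmulDl _ _ _) (twmul0g g)). Qed.
Let twmul_sumr I (r : seq I) (F : I -> T) g :
  twmul g (\sum_(i <- r) F i) = \sum_(i <- r) twmul g (F i).
Proof. exact: (big_morph (twmul g) (fun _ _ => twmulDr _ _ _) (twmulg0 g)). Qed.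

Lemma twistedE g : g = \sum_(m <- msupp g) (<< g@_m *g m >> : T).
Proof. exact: monalgE. Qed.

Fact twmulA : associative twmul.
Proof.
move=> g1 g2 g3; rewrite [g1]twistedE !twmul_suml; apply: eq_bigr => m1 _.
rewrite [g2]twistedE twmul_suml !twmul_sumr twmul_suml.
apply: eq_bigr => m2 _.
rewrite [g3]twistedE !twmul_sumr; apply: eq_bigr => m3 _.
by rewrite !twmulUU rmorphM actM mulgA mulrA.
Qed.

Fact twmul1g : left_id twone twmul.
Proof.
move=> g; rewrite [in LHS](twistedE g) twmul_sumr [in RHS](twistedE g).
by apply: eq_bigr => m _; rewrite twmulUU act1 mul1r mul1g.
Qed.

Fact twmulg1 : right_id twone twmul.
Proof.
move=> g; rewrite [in LHS](twistedE g) twmul_suml [in RHS](twistedE g).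
by apply: eq_bigr => m _; rewrite twmulUU rmorph1 mulr1 mulg1.
Qed.

Fact twone_neq0 : twone != 0.
Proof. by rewrite monalgU_eq0 oner_eq0. Qed.

HB.instance Definition _ := GRing.Zmodule_isNzRing.Build T
  twmulA twmul1g twmulg1 twmulDl twmulDr twone_neq0.

Lemma scale_twU c a m : c *: (<< a *g m >> : T) = << c *: a *g m >>.
Proof.
apply/malgP=> m'; rewrite twscaleE !mcoeffU.
by case: eqP; rewrite ?mulr1n // !mulr0n scaler0.
Qed.

Fact twscaleAl c g1 g2 : c *: (g1 * g2) = c *: g1 * g2.
Proof.
rewrite [g1]twistedE mulr_suml !scaler_sumr mulr_suml; apply: eq_bigr => m1 _.
rewrite [g2]twistedE !mulr_sumr scaler_sumr; apply: eq_bigr => m2 _.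
rewrite scale_twU /GRing.mul /= !twmulUU scale_twU.
by rewrite scalerAl.
Qed.

HB.instance Definition _ := GRing.Lmodule_isLalgebra.Build k T twscaleAl.

Fact twscaleAr c g1 g2 : c *: (g1 * g2) = g1 * (c *: g2).
Proof.
rewrite [g1]twistedE !mulr_suml !scaler_sumr; apply: eq_bigr => m1 _.
rewrite [g2]twistedE mulr_sumr !scaler_sumr mulr_sumr.
apply: eq_bigr => m2 _.
rewrite scale_twU /GRing.mul /= !twmulUU scale_twU.
by rewrite linearZ scalerAr.
Qed.

HB.instance Definition _ := GRing.Lalgebra_isAlgebra.Build k T twscaleAr.

End Twisted.

(* The monoid algebra kM, as the case A = k with trivial action.              *)
Definition monoidAlg (k : comNzRingType) (M : monoidType) : algType k :=
  twisted (@one_fun M (algAut k^o)).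

Definition of_monoid (k : comNzRingType) (M : monoidType) (m : M) :
  monoidAlg k M := << 1 *g m >>.

Section Tensor.
Context {k : comNzRingType} {A : algType k} {M : monoidType}.
Context (act : UMagmaMorphism.type M (algAut A)).

Local Notation T := (twisted act).
Local Notation kM := (monoidAlg k M).

(* The pure tensor a (x) x in A (x)_tau kM.                                   *)
Definition tens (a : A) (x : kM) : T :=
  \sum_(m <- msupp x) << (x@_m : k) *: a *g m >>.

Definition embA (a : A) : T := tens a 1.
Definition embM (x : kM) : T := tens 1 x.

Lemma tensE a x m : (tens a x)@_m = (x@_m : k) *: a.
Proof.
rewrite /tens raddf_sum /=; have [mx|mNx] := msuppP x m.
  rewrite (big_fsetD1 m) //= mcoeffUU big1_fset ?addr0 // => m'.
  by rewrite in_fsetD1 mcoeffU; case: eqP.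
rewrite scale0r big1_fset // => m' m'x _.
by rewrite mcoeffU; case: eqP m'x mNx => // -> ->.
Qed.

Lemma tens_of_monoid a m : tens a (of_monoid k m) = << a *g m >>.
Proof.
apply/malgP => m'; rewrite tensE /of_monoid !mcoeffU.
by case: eqP => _; rewrite ?mulr1n ?scale1r // !mulr0n scale0r.
Qed.

Lemma tens_linearl x : linear (tens^~ x).
Proof.
move=> c a b; apply/malgP => m; rewrite mcoeffD /=.
by rewrite [in RHS]twscaleE !tensE scalerDr !scalerA mulrC.
Qed.

Lemma tens_linearr a : linear (tens a).
Proof.
move=> c x y; apply/malgP => m; rewrite mcoeffD /=.
by rewrite [in RHS]twscaleE !tensE mcoeffD twscaleE scalerDl scalerA.
Qed.

Lemma tens_mul a b m m' :
  tens a (of_monoid k m) * tens b (of_monoid k m') =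
  tens (a * act m b) (of_monoid k (m * m')%g).
Proof. by rewrite !tens_of_monoid [LHS]twmulUU. Qed.

Lemma of_monoidM m m' :
  (of_monoid k m : kM) * of_monoid k m' = of_monoid k (m * m')%g.
Proof. by rewrite [LHS]twmulUU /= mul1r. Qed.

Lemma monoidAlgE (x : kM) :
  x = \sum_(m <- msupp x) (x@_m : k) *: of_monoid k m.
Proof.
rewrite {1}[x]twistedE; apply: eq_bigr => m _.
by rewrite /of_monoid scale_twU; congr << _ *g _ >>; rewrite /GRing.scale /= mulr1.
Qed.

(* A (x) kM is generated by its pure tensors, and (a, x) |-> a (x) x is the   *)
(* universal k-bilinear map.                                                  *)
Lemma tens_span (t : T) :
  t = \sum_(m <- msupp t) tens (t@_m) (of_monoid k m).
Proof.
rewrite {1}[t]twistedE; apply: eq_bigr => m _; exact/esym/tens_of_monoid.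
Qed.

Lemma tens_univ (V : lmodType k) (f : A -> kM -> V) :
  (forall x, linear (f^~ x)) -> (forall a, linear (f a)) ->
  exists2 F : {linear T -> V}, (forall a x, F (tens a x) = f a x) &
    forall F' : {linear T -> V}, (forall a x, F' (tens a x) = f a x) -> F' =1 F.
Proof.
move=> fl fr.
pose fL x := GRing.isLinear.Build k A V *:%R (f^~ x) (fl x).
pose fLx x : {linear A -> V} := HB.pack (f^~ x) (fL x).
pose fR a := GRing.isLinear.Build k kM V *:%R (f a) (fr a).
pose fRa a : {linear kM -> V} := HB.pack (f a) (fR a).
pose F (t : T) := \sum_(m <- msupp t) f (t@_m) (of_monoid k m).
have FE (d : {fset M}) t : msupp t `<=` d ->
    F t = \sum_(m <- d) f (t@_m) (of_monoid k m).
  move=> td; apply/big_fset_incl => // m _ /mcoeff_outdom ->.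
  exact: (linear0 (fLx (of_monoid k m))).
have Fl : linear F.
  move=> c t u; pose d := msupp t `|` msupp u `|` msupp (c *: t + u).
  rewrite (FE d) ?fsubsetUr // (FE d t) ?(FE d u); first last.
  - by rewrite /d -fsetUA fsubsetUl.
  - by rewrite /d -fsetUA fsetUCA fsubsetUl.
  rewrite scaler_sumr -big_split /=; apply: eq_bigr => m _.
  by rewrite mcoeffD twscaleE fl.
pose FL := GRing.isLinear.Build k T V *:%R F Fl.
exists (HB.pack F FL : {linear T -> V}) => /=.
  move=> a x.
  rewrite (FE (msupp x)); last first.
    apply/fsubsetP => m; rewrite -!mcoeff_neq0 tensE.
    by apply: contraNneq => ->; rewrite scale0r.
  transitivity (fRa a x) => //; rewrite [in RHS](monoidAlgE x) linear_sum.
  apply: eq_bigr => m _; rewrite tensE [RHS]linearZ.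
  exact: (linearZ_LR (fLx (of_monoid k m))).
move=> F' F'E t; rewrite /= [in LHS](tens_span t) linear_sum.
by apply: eq_bigr => m _; rewrite F'E.
Qed.

Fact embA_linear : linear embA. Proof. exact: tens_linearl. Qed.
Fact embA_monoid : monoid_morphism embA.
Proof.
split=> [|a b]; first by rewrite /embA tens_of_monoid.
by rewrite /embA tens_mul gmulf1 mulg1.
Qed.
HB.instance Definition _ := GRing.isLinear.Build k A T *:%R embA embA_linear.
HB.instance Definition _ := GRing.isMonoidMorphism.Build A T embA embA_monoid.

Fact embM_linear : linear embM. Proof. exact: tens_linearr. Qed.
HB.instance Definition _ := GRing.isLinear.Build k kM T *:%R embM embM_linear.

Fact embM_monoid : monoid_morphism embM.
Proof.
split=> [|x y]; first by rewrite /embM tens_of_monoid.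
rewrite [x]monoidAlgE [y]monoidAlgE mulr_suml !linear_sum mulr_suml.
apply: eq_bigr => m _; rewrite mulr_sumr !linear_sum mulr_sumr.
apply: eq_bigr => m' _.
rewrite -scalerAl -scalerAr !linearZ /= -scalerAl -scalerAr of_monoidM /embM.
by rewrite tens_mul rmorph1 mulr1.
Qed.
HB.instance Definition _ := GRing.isMonoidMorphism.Build kM T embM embM_monoid.

Lemma embA_inj : injective embA.
Proof.
move=> a b /malgP/(_ 1%g); rewrite /embA !tens_of_monoid.
by rewrite !mcoeffUU.
Qed.

End Tensor.

Record centralSubalg (k : comNzRingType) (P : algType k) := CentralSubalg {
  csub_pred :> {pred P};
  csub_closed : GRing.subalg_closed csub_pred;
  csub_central : forall q p, q \in csub_pred -> q * p = p * q }.

Record csub_type (k : comNzRingType) (P : algType k) (Q : centralSubalg P) :=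
  CsubElt { csub_val :> P; csub_valP : csub_val \in csub_pred Q }.

HB.instance Definition _ (k : comNzRingType) (P : algType k)
  (Q : centralSubalg P) := [isSub for @csub_val k P Q].
HB.instance Definition _ (k : comNzRingType) (P : algType k)
  (Q : centralSubalg P) := [Choice of csub_type Q by <:].

Section CentralSubalgType.
Context {k : comNzRingType} {P : algType k} (Q : centralSubalg P).

Fact csub_subring_closed : subring_closed (csub_pred Q).
Proof. exact: GRing.subalg_closedBM (csub_closed Q). Qed.

HB.instance Definition _ :=
  GRing.SubChoice_isSubNzRing.Build P (mem (csub_pred Q)) (csub_type Q) csub_subring_closed.

Fact csub_mulC : commutative (@GRing.mul (csub_type Q)).
Proof.
move=> p q; apply: val_inj; rewrite !rmorphM /=.
exact: csub_central (valP p).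
Qed.

HB.instance Definition _ :=
  GRing.PzRing_hasCommutativeMul.Build (csub_type Q) csub_mulC.

End CentralSubalgType.

Section Discriminant.
Context {k : comNzRingType} {P : algType k} (Q : centralSubalg P).

Local Notation Qt := (csub_type Q).

Definition is_basis N (z : 'I_N -> P) : Prop :=
  forall p, exists! c : 'rV[Qt]_N, p = \sum_i val (c 0 i) * z i.

Definition free_of_rank (N : nat) : Prop :=
  exists z : 'I_N -> P, is_basis z.

Section Basis.
Context {N : nat} {z : 'I_N -> P} (zB : is_basis z).

Definition coord (p : P) : 'rV[Qt]_N := sval (cid (zB p)).

Lemma coordE p : p = \sum_i val (coord p 0 i) * z i.
Proof. by rewrite /coord; case: cid => c []. Qed.

(* The matrix of left multiplication by p: its j-th column holds the          *)
(* coordinates of p * z_j.                                                    *)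
Definition lmul_mx (p : P) : 'M[Qt]_N := \matrix_(i, j) coord (p * z j) 0 i.

Definition reg_tr (p : P) : Qt := \tr (lmul_mx p).

Definition disc : Qt := \det (\matrix_(i, j) reg_tr (z i * z j)).
End Basis.

(* d is (a representative of) d(P/Q).                                         *)
Definition is_disc (d : Qt) : Prop :=
  exists N (z : 'I_N -> P) (zB : is_basis z), d = disc zB.

Definition eq_upto_unit (x y : P) : Prop :=
  exists c c' : Qt, c * c' = 1 /\ x = val c * y.

End Discriminant.

Section Subalgebras.
Context {k : comNzRingType} {A : algType k} {M : monoidType}.
Context (act : UMagmaMorphism.type M (algAut A)).

Local Notation T := (twisted act).
Local Notation kM := (monoidAlg k M).

Definition capA_pred (R : centralSubalg T) : {pred A} :=
  [pred a | embA act a \in csub_pred R].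

Fact capA_closed (R : centralSubalg T) : GRing.subalg_closed (capA_pred R).
Proof.
have [R1 Rlin RM] := csub_closed R; split => [|c a b|a b].
- by rewrite inE rmorph1.
- by rewrite !inE linearP; apply: Rlin.
- by rewrite !inE rmorphM; apply: RM.
Qed.

Fact capA_central (R : centralSubalg T) a b :
  a \in capA_pred R -> a * b = b * a.
Proof.
rewrite inE => aR; apply: (@embA_inj _ _ _ act).
by rewrite !rmorphM; exact: (@csub_central _ _ R _ _ aR).
Qed.

Definition capA (R : centralSubalg T) : centralSubalg A :=
  CentralSubalg (capA_closed R) (@capA_central R).

(* The span in A (x)_tau kM of the a (x) x with a in B and x in S.            *)
Definition tens_span_of (B : {pred A}) (S : {pred kM}) (t : T) : Prop :=
  exists2 s : seq (A * kM), {in s, forall u, u.1 \in B /\ u.2 \in S} &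
    t = \sum_(u <- s) tens act u.1 u.2.

End Subalgebras.

Section SubmonoidAlgebra.
Context {k : comNzRingType} {M : monoidType} (H : M -> Prop).
Local Notation kM := (monoidAlg k M).

Definition kspan_pred : {pred kM} :=
  fun x => `[< forall m, x@_m != 0 -> H m >].

Lemma kspanP (x : kM) :
  reflect (forall m, x@_m != 0 -> H m) (x \in kspan_pred).
Proof. exact: asboolP. Qed.

Hypothesis H1 : H 1%g.
Hypothesis HM : forall m m', H m -> H m' -> H (m * m')%g.
Hypothesis HC : forall h m, H h -> commute h m.

Lemma kspanD x y : x \in kspan_pred -> y \in kspan_pred -> x + y \in kspan_pred.
Proof.
move=> /kspanP xH /kspanP yH; apply/kspanP => m; rewrite mcoeffD.
have [->|/xH //] := eqVneq (x@_m) 0; rewrite add0r; exact: yH.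
Qed.

Lemma kspan0 : 0 \in kspan_pred.
Proof. by apply/kspanP => m; rewrite mcoeff0 eqxx. Qed.

Lemma kspanU c m : H m -> << c *g m >> \in kspan_pred.
Proof.
by move=> Hm; apply/kspanP => m'; rewrite mcoeffU; case: (m =P m') => [<- //|_]; rewrite eqxx.
Qed.

Fact kspan_closed : GRing.subalg_closed kspan_pred.
Proof.
split.
- exact: kspanU.
- move=> c x y xH yH; apply: kspanD yH; apply/kspanP => m.
  rewrite twscaleE => cx; apply: (kspanP _ xH).
  by apply: contraNneq cx => ->; rewrite scaler0.
- move=> x y /kspanP xH /kspanP yH.
  rewrite [x * y]/(twmul _ _) /twmul big_seq.
  apply: (big_ind (fun t : kM => t \in kspan_pred)) => [||m mx].
  + exact: kspan0.
  + exact: kspanD.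
  rewrite big_seq; apply: (big_ind (fun t : kM => t \in kspan_pred)) => [||m' my].
  + exact: kspan0.
  + exact: kspanD.
  by apply/kspanU/HM; [apply: xH | apply: yH]; rewrite mcoeff_neq0.
Qed.

Fact kspan_central x y : x \in kspan_pred -> x * y = y * x.
Proof.
move=> /kspanP xH; rewrite [x]twistedE [y]twistedE mulr_suml mulr_sumr.
rewrite big_seq [RHS]big_seq; apply: eq_bigr => m mx.
rewrite mulr_suml mulr_sumr; apply: eq_bigr => m' _.
rewrite [LHS]twmulUU [RHS]twmulUU /= HC; first by rewrite [_ * _ in LHS]mulrC.
by apply: xH; rewrite mcoeff_neq0.
Qed.

Definition submonoidAlg : centralSubalg kM :=
  CentralSubalg kspan_closed kspan_central.

End SubmonoidAlgebra.

Section KernelAlgebra.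
Context {k : comNzRingType} {A : algType k} {M : monoidType}.
Context (act : UMagmaMorphism.type M (algAut A)).

Definition act_ker (m : M) : Prop := act m = 1%g.

Fact act_ker1 : act_ker 1%g.
Proof. exact: gmulf1. Qed.

Fact act_kerM m m' : act_ker m -> act_ker m' -> act_ker (m * m')%g.
Proof. by rewrite /act_ker gmulfM => -> ->; rewrite mulg1. Qed.

Definition kerAlg (HC : forall h m, act_ker h -> commute h m) :
    centralSubalg (monoidAlg k M) :=
  submonoidAlg act_ker1 act_kerM HC.

End KernelAlgebra.

Definition restrict_act (k : comNzRingType) (A : algType k) (G : groupType)
    (rho : UMagmaMorphism.type G (algAut A)) (S : pred G) (M : subMonoidType S) :
  UMagmaMorphism.type M (algAut A) := rho \o (val : M -> G).

(* Main.v *)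
(** Let [tr_A] be the trace of [A] over [capA R].  Since [M] is cancellative and
    each element of [M] is uniquely [h * m_j] with [h] in [H], left
    multiplication by [a (x) y] moves every [m_j]-component of [T] away from
    itself unless [y] lies in [H]; hence [tr (a (x) y)] is [l tr_A(a) y] for [y]
    in [H], and [0] otherwise.  The discriminant can be computed, up to a unit,
    from [tr (u_i w_j)] for two different bases [u] and [w].  Taking
    [u = (x_i m_j)] and [w = (m_q x_p)], the product [x_i (m_j m_q) x_p] has
    trace [tr_A(x_i x_p) tr(m_j m_q)], so that the matrix is the Kronecker
    product of the two trace matrices, and its determinant is
    [d(A)^l d(kM)^n]. *)
From HB Require Import structures.
Require Import Defs.
From mathcomp Require Import all_boot all_algebra.
From mathcomp Require Import fingroup perm finmap boolp mxtens.
From mathcomp.multinomials Require Import monalg.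

Set Implicit Arguments.
Unset Strict Implicit.
Unset Printing Implicit Defensive.

Import GRing.Theory.
Local Open Scope ring_scope.

(* [all_algebra] shadows it by the coordinates of [vector]. *)
Local Notation coord := Defs.coord.

(** * Determinant of a Kronecker product *)

Section Determinants.
Variable R : comNzRingType.

(** Once [m = n], the reindexing permutes rows and columns by the same permutation, and the two
    signs cancel. *)
Lemma det_mxsub_bij m n (f : 'I_m -> 'I_n) (A : 'M[R]_n) :
  bijective f -> \det (mxsub f f A) = \det A.
Proof.
move=> fB; have mn : m = n by rewrite -(card_ord m) -(card_ord n); apply: bij_eq_card fB.
subst m; have [g fK _] := fB; pose s := perm (can_inj fK).
have ->: mxsub f f A = row_perm s (col_perm s A).
  by apply/matrixP => i j; rewrite !mxE !permE.
rewrite col_permE row_permE !det_mulmx !det_perm odd_permV mulrA mulrAC.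
by rewrite -signr_addb addbb mul1r.
Qed.

(** The matrix is block diagonal with [n] copies of [B]; the induction splits off the first
    block. *)
Lemma det_tens1mx n q (B : 'M[R]_q) :
  \det ((1%:M : 'M_n) *t B) = \det B ^+ n.
Proof.
elim: n => [|n IHn]; first by rewrite det_mx00 expr0.
have ->: (1%:M : 'M_n.+1) *t B =
    block_mx B 0 0 ((1%:M : 'M_n) *t B) :> 'M_(q + n * q).
  apply/matrixP => p r.
  case: (mxtens_indexP (p : 'I_(n.+1 * q))) => i j.
  case: (mxtens_indexP (r : 'I_(n.+1 * q))) => i' j'.
  have iL h : mxtens_index (ord0, h) = lshift (n * q) h :> 'I_(n.+1 * q).
    exact: val_inj.
  have iR s h : mxtens_index (lift ord0 s, h) = rshift q (mxtens_index (s, h))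
      :> 'I_(n.+1 * q).
    by apply: val_inj => /=; rewrite /bump mulSn addnA.
  rewrite [LHS](tensmxE (1%:M : 'M_n.+1) B i j i' j') mxE.
  case: (unliftP ord0 i) => [s|] ->; case: (unliftP ord0 i') => [s'|] ->.
  - by rewrite !iR block_mxEdr tensmxE mxE (inj_eq lift_inj).
  - by rewrite iR iL block_mxEdl mxE mul0r.
  - by rewrite iR iL block_mxEur mxE mul0r.
  - by rewrite !iL block_mxEul mul1r.
by rewrite det_ublock IHn exprS.
Qed.

Lemma det_tensmx n q (A : 'M[R]_n) (B : 'M[R]_q) :
  \det (A *t B) = \det A ^+ q * \det B ^+ n.
Proof.
rewrite tensmx_decr det_mulmx det_tens1mx; congr (_ * _).
rewrite -det_tens1mx.
(* Swapping the two index components turns the remaining factor [A *t 1] into [1 *t A]. *)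
pose f (p : 'I_(n * q)) := let: (i, j) := mxtens_unindex p in mxtens_index (j, i).
pose g (p : 'I_(q * n)) := let: (i, j) := mxtens_unindex p in mxtens_index (j, i).
have fB : bijective f.
  by exists g; move=> p; case: (mxtens_indexP p) => i j;
    rewrite /f /g !mxtens_indexK.
rewrite -(det_mxsub_bij _ fB); congr (\det _); apply/matrixP => p r.
case: (mxtens_indexP p) => i j; case: (mxtens_indexP r) => i' j'.
by rewrite [RHS]mxE /f !mxtens_indexK !tensmxE mulrC.
Qed.

End Determinants.

(** * Coordinates, traces and change of basis over a central subalgebra *)

Section Bases.
Context {k : comNzRingType} {P : algType k} (Q : centralSubalg P).
Local Notation Qt := (csub_type Q).

Lemma csub_valM (p q : Qt) : val (p * q) = val p * val q.
Proof. exact: (rmorphM (val : Qt -> P)). Qed.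

Lemma csub_valD (p q : Qt) : val (p + q) = val p + val q.
Proof. exact: (raddfD (val : Qt -> P)). Qed.

Lemma csub_valB (p q : Qt) : val (p - q) = val p - val q.
Proof. exact: (raddfB (val : Qt -> P)). Qed.

Lemma csub_val0 : val (0 : Qt) = 0.
Proof. exact: (raddf0 (val : Qt -> P)). Qed.

Lemma csub_val1 : val (1 : Qt) = 1.
Proof. exact: (rmorph1 (val : Qt -> P)). Qed.

Lemma csub_val_sum I (r : seq I) (F : I -> Qt) :
  val (\sum_(i <- r) F i) = \sum_(i <- r) val (F i).
Proof. exact: (raddf_sum (val : Qt -> P)). Qed.

Lemma is_basis_intro N (z : 'I_N -> P) :
  (forall p, exists c : 'rV[Qt]_N, p = \sum_i val (c 0 i) * z i) ->
  (forall c : 'rV[Qt]_N, \sum_i val (c 0 i) * z i = 0 -> c = 0) ->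
  is_basis Q z.
Proof.
move=> span indep p; have [c pE] := span p; exists c; split=> // c' p'E.
apply/eqP; rewrite -subr_eq0; apply/eqP/indep.
rewrite -[RHS](subrr p) {1}pE {1}p'E -sumrB; apply: eq_bigr => i _.
by rewrite !mxE csub_valB mulrBl.
Qed.

Section OneBasis.
Context {N : nat} {z : 'I_N -> P} (zB : is_basis Q z).

Lemma coord_uniq p (c : 'rV[Qt]_N) :
  p = \sum_i val (c 0 i) * z i -> coord zB p = c.
Proof.
move=> pE; have [b [bE bU]] := zB p.
by rewrite -(bU _ (coordE zB p)) (bU _ pE).
Qed.

Lemma coord_lincomb I (r : seq I) (c : I -> Qt) (p : I -> P) :
  coord zB (\sum_(i <- r) val (c i) * p i) = \sum_(i <- r) c i *: coord zB (p i).
Proof.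
apply: coord_uniq; under [RHS]eq_bigr do rewrite summxE csub_val_sum mulr_suml.
rewrite exchange_big; apply: eq_bigr => i _.
rewrite {1}(coordE zB (p i)) mulr_sumr; apply: eq_bigr => j _.
by rewrite mxE csub_valM mulrA.
Qed.

Lemma coordZ (c : Qt) p : coord zB (val c * p) = c *: coord zB p.
Proof. by have := coord_lincomb [:: tt] (fun=> c) (fun=> p); rewrite !big_seq1. Qed.

Lemma coord_delta i : coord zB (z i) = delta_mx 0 i.
Proof.
apply: coord_uniq; rewrite (bigD1 i) //= mxE !eqxx csub_val1 mul1r big1 ?addr0 //.
by move=> j /negbTE ji; rewrite mxE ji andbF csub_val0 mul0r.
Qed.

Lemma reg_tr_lincomb I (r : seq I) (c : I -> Qt) (p : I -> P) :
  reg_tr zB (\sum_(i <- r) val (c i) * p i) = \sum_(i <- r) c i * reg_tr zB (p i).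
Proof.
rewrite /reg_tr /mxtrace; under [RHS]eq_bigr do rewrite mulr_sumr.
rewrite exchange_big; apply: eq_bigr => j _; rewrite mxE mulr_suml.
under [X in coord _ X]eq_bigr do rewrite -mulrA.
by rewrite coord_lincomb summxE; apply: eq_bigr => i _; rewrite !mxE.
Qed.

Lemma reg_trZ (c : Qt) p : reg_tr zB (val c * p) = c * reg_tr zB p.
Proof. by have := reg_tr_lincomb [:: tt] (fun=> c) (fun=> p); rewrite !big_seq1. Qed.

Lemma reg_tr_val (c : Qt) : reg_tr zB (val c) = c *+ N.
Proof.
rewrite -[val c]mulr1 reg_trZ -[RHS]mulr_natr; congr (_ * _).
rewrite /reg_tr /mxtrace.
under eq_bigr do rewrite mxE mul1r coord_delta mxE !eqxx.
by rewrite sumr_const card_ord.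
Qed.

(** Coordinates are stored in rows, so that a change of basis multiplies on the right. *)
Definition trans_mx N' (w : 'I_N' -> P) : 'M[Qt]_(N', N) :=
  \matrix_i coord zB (w i).

(** Rows and columns may come from different families, both unrelated to the basis [z] that computes
    the trace; for [u = w = z] the determinant is [disc]. *)
Definition gram_mx N1 N2 (u : 'I_N1 -> P) (w : 'I_N2 -> P) : 'M[Qt]_(N1, N2) :=
  \matrix_(i, j) reg_tr zB (u i * w j).

End OneBasis.

Section TwoBases.
Context {N N' : nat} {z : 'I_N -> P} {w : 'I_N' -> P}.
Hypotheses (zB : is_basis Q z) (wB : is_basis Q w).

Lemma coord_trans p : coord zB p = coord wB p *m trans_mx zB w.
Proof.
rewrite {1}(coordE wB p) coord_lincomb mulmx_sum_row.
by apply: eq_bigr => i _; rewrite rowK.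
Qed.

Lemma trans_mx_comp N'' (u : 'I_N'' -> P) :
  trans_mx zB u = trans_mx wB u *m trans_mx zB w.
Proof. by apply/row_matrixP => i; rewrite row_mul !rowK coord_trans. Qed.

Lemma trans_mxx : trans_mx zB z = 1%:M.
Proof. by apply/row_matrixP => i; rewrite rowK coord_delta row1. Qed.

End TwoBases.

Section BasisChange.
Context {N N' : nat} {z : 'I_N -> P} {w : 'I_N' -> P}.
Hypotheses (zB : is_basis Q z) (wB : is_basis Q w).

Lemma trans_mxK : trans_mx wB z *m trans_mx zB w = 1%:M.
Proof. by rewrite -trans_mx_comp trans_mxx. Qed.

(** The matrices of multiplication by [p] in the two bases are conjugate under the transition
    matrix, and the trace is cyclic. *)
Lemma reg_tr_indep p : reg_tr zB p = reg_tr wB p.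
Proof.
have trE N1 (v : 'I_N1 -> P) (vB : is_basis Q v) :
    reg_tr vB p = \tr (trans_mx vB (fun i => p * v i)).
  by apply: eq_bigr => i _; rewrite !mxE.
have ->: reg_tr zB p = \tr (trans_mx wB z *m trans_mx zB (fun i => p * w i)).
  rewrite trE; congr (\tr _); apply/row_matrixP => i.
  rewrite row_mul !rowK mulmx_sum_row {1}(coordE wB (z i)) mulr_sumr.
  (* The coefficients of [z i] are central, hence can be moved to the left of [p]. *)
  under eq_bigr do rewrite mulrA -(csub_central _ (valP _)) -mulrA.
  by rewrite coord_lincomb; apply: eq_bigr => j _; rewrite rowK.
rewrite mxtrace_mulC (trans_mx_comp zB wB) trE.
rewrite -mulmxA -[trans_mx zB w *m _]trans_mx_comp trans_mxx mulmx1 //.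
Qed.

End BasisChange.

(** The transition matrices are inverse to each other on both sides, which over a nonzero
    commutative ring forces them to be square. *)
Lemma basis_size N N' (z : 'I_N -> P) (w : 'I_N' -> P) :
  is_basis Q z -> is_basis Q w -> N = N'.
Proof.
move=> zB wB; apply/anti_leq/andP.
by split; [apply: mulmx1_min (trans_mxK zB wB) | apply: mulmx1_min (trans_mxK wB zB)].
Qed.

Lemma gram_mx_transl N N' (z : 'I_N -> P) (w : 'I_N' -> P) (zB : is_basis Q z)
    N1 (u : 'I_N1 -> P) :
  gram_mx zB u w = trans_mx zB u *m gram_mx zB z w.
Proof.
apply/matrixP => i j; rewrite !mxE {1}(coordE zB (u i)) mulr_suml.
under eq_bigr do rewrite -mulrA.
by rewrite reg_tr_lincomb; apply: eq_bigr => s _; rewrite !mxE.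
Qed.

Lemma gram_mx_transr N N' (z : 'I_N -> P) (u : 'I_N' -> P) (zB : is_basis Q z)
    N1 (w : 'I_N1 -> P) :
  gram_mx zB u w = gram_mx zB u z *m (trans_mx zB w)^T.
Proof.
apply/matrixP => i j; rewrite !mxE {1}(coordE zB (w j)) mulr_sumr.
under eq_bigr do rewrite mulrA -(csub_central _ (valP _)) -mulrA.
by rewrite reg_tr_lincomb; apply: eq_bigr => s _; rewrite !mxE mulrC.
Qed.

(** Rows and columns of the trace matrix can be rewritten independently, each at the cost of an
    invertible transition matrix. This permits two different bases of [T] in the main
    computation. *)
Lemma disc_gram N (z u w : 'I_N -> P) (zB : is_basis Q z) (uB : is_basis Q u) :
  is_basis Q w ->
  exists c c', c * c' = 1 /\ disc zB = c * \det (gram_mx uB u w).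
Proof.
move=> wB.
exists (\det (trans_mx uB z) * \det (trans_mx wB z)).
exists (\det (trans_mx zB u) * \det (trans_mx zB w)); split.
  by rewrite mulrACA -!det_mulmx !trans_mxK mul1mx det1.
have ->: disc zB = \det (gram_mx uB z z).
  by congr (\det _); apply/matrixP => i j; rewrite !mxE (reg_tr_indep zB uB).
rewrite gram_mx_transl det_mulmx.
have ->: gram_mx uB u z = gram_mx uB u w *m (trans_mx wB z)^T.
  rewrite gram_mx_transr (trans_mx_comp uB wB) trmx_mul mulmxA.
  by rewrite -gram_mx_transr.
by rewrite det_mulmx det_tr mulrA mulrAC.
Qed.

Lemma disc_indep N N' (z : 'I_N -> P) (w : 'I_N' -> P)
    (zB : is_basis Q z) (wB : is_basis Q w) :
  exists c c', c * c' = 1 /\ disc zB = c * disc wB.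
Proof.
have NN' := basis_size zB wB; subst N'; exact: (disc_gram zB wB wB).
Qed.

(** Such an [f] is [Q]-linear and bijective. It will be the action of some [m j] on [A], which fixes
    [capA R]. *)
Lemma is_basis_aut (f : algAut P) N (z : 'I_N -> P) :
  (forall q : csub_type Q, f (val q) = val q) ->
  is_basis Q z -> is_basis Q (fun i => f (z i)).
Proof.
move=> fQ zB.
have fE (c : 'rV[csub_type Q]_N) :
    f (\sum_i val (c 0 i) * z i) = \sum_i val (c 0 i) * f (z i).
  by rewrite rmorph_sum; apply: eq_bigr => i _; rewrite rmorphM; congr (_ * _); exact: fQ.
apply: is_basis_intro => [p|c].
  exists (coord zB ((f^-1)%g p)).
  by rewrite -fE -(coordE zB) -autME mulgV.
rewrite -fE => /(congr1 (f^-1)%g); rewrite -autME mulVg aut1E raddf0 => c0.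
rewrite -(coord_uniq zB (esym c0)); apply: coord_uniq.
by rewrite big1 // => i _; rewrite mxE csub_val0 mul0r.
Qed.

End Bases.

(** * Ring morphisms between central subalgebras, along which determinants are transported *)

Section SubalgMap.
Context {k : comNzRingType} {P P' : algType k}.
Context (Q : centralSubalg P) (Q' : centralSubalg P') (f : {rmorphism P -> P'}).
Hypothesis fQ : forall q, q \in csub_pred Q -> f q \in csub_pred Q'.

Definition csub_map (q : csub_type Q) : csub_type Q' := CsubElt (fQ (csub_valP q)).

Fact csub_map_zmod_morphism : zmod_morphism csub_map.
Proof.
move=> p q; apply: val_inj; rewrite csub_valB.
exact: etrans (congr1 f (csub_valB p q)) (rmorphB f _ _).
Qed.

Fact csub_map_monoid_morphism : monoid_morphism csub_map.
Proof.
split=> [|p q]; apply: val_inj.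
  by rewrite csub_val1; exact: etrans (congr1 f (csub_val1 Q)) (rmorph1 f).
by rewrite csub_valM; exact: etrans (congr1 f (csub_valM p q)) (rmorphM f _ _).
Qed.

HB.instance Definition _ := GRing.isZmodMorphism.Build _ _ csub_map
  csub_map_zmod_morphism.
HB.instance Definition _ := GRing.isMonoidMorphism.Build _ _ csub_map
  csub_map_monoid_morphism.

End SubalgMap.

(** * Coefficients of products in the twisted tensor product *)

Section TwistedCoefficients.
Context {k : comNzRingType} {A : algType k} {M : monoidType}.
Context (act : UMagmaMorphism.type M (algAut A)).
Local Notation T := (twisted act).
Implicit Types (t : T) (a b : A) (x y : M).

Lemma twistedU_mul a b x y :
  (<< a *g x >> : T) * << b *g y >> = << a * act x b *g (x * y)%g >>.
Proof. exact: twmulUU. Qed.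

Lemma twisted_mulU t b y :
  t * (<< b *g y >> : T) = \sum_(x <- msupp t) << t@_x * act x b *g (x * y)%g >>.
Proof.
rewrite {1}[t]twistedE mulr_suml; apply: eq_bigr => x _; exact: twistedU_mul.
Qed.

Lemma mcoeff_mulU_neq0 t b y z :
  (t * (<< b *g y >> : T))@_z != 0 -> exists2 x, t@_x != 0 & z = (x * y)%g.
Proof.
rewrite twisted_mulU raddf_sum => tz; apply: contrapT => none.
move/negP: tz; apply; rewrite big_seq big1 // => x xt /=.
rewrite mcoeffU; case: eqP => // xyz.
by case: none; exists x; rewrite ?mcoeff_neq0.
Qed.

Hypothesis mulM_inj : @left_injective M M M (fun x y => (x * y)%g).

(** By right cancellation [x] is the only element whose product with [y] is [x * y], so a single
    term survives. *)
Lemma mcoeff_mulU t b x y : (t * (<< b *g y >> : T))@_(x * y)%g = t@_x * act x b.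
Proof.
rewrite twisted_mulU raddf_sum /=.
have [xt|xNt] := msuppP t x.
  rewrite (big_fsetD1 x) //= mcoeffUU big1_fset ?addr0 // => x'.
  by rewrite in_fsetD1 mcoeffU => /andP[x'x _] _;
    rewrite (inj_eq (@mulM_inj _)) (negbTE x'x).
rewrite mul0r big1_fset // => x' x't _.
rewrite mcoeffU (inj_eq (@mulM_inj _)); case: eqP => // xx'.
by rewrite -xx' x't in xNt.
Qed.

End TwistedCoefficients.

Lemma sum_mxtens (V : nmodType) n l (F : 'I_(n * l) -> V) :
  \sum_p F p = \sum_i \sum_j F (mxtens_index (i, j)).
Proof.
rewrite pair_bigA (reindex (@mxtens_index n l)) /=.
  by apply: eq_bigr => -[].
exists (@mxtens_unindex n l) => p _; [exact: mxtens_indexK | exact: mxtens_unindexK].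
Qed.

Lemma monalgU_sum (V : zmodType) (K : choiceType) (y : K) I (r : seq I) (F : I -> V) :
  << \sum_(i <- r) F i *g y >> = \sum_(i <- r) << F i *g y >> :> {malg V[K]}.
Proof. exact: raddf_sum. Qed.

(** * The cosets [H m_j] in [M], and the trace of [kM] over [kH] *)

Section Cosets.
Context {k : comNzRingType} {A : algType k} {M : monoidType}.
Context (act : UMagmaMorphism.type M (algAut A)).
Hypothesis mulM_inj : @left_injective M M M (fun x y => (x * y)%g).
Hypothesis HC : forall h x : M, act_ker act h -> commute h x.
Local Notation kH := (kerAlg HC).
Context {l : nat} {m : 'I_l -> M}.
Hypothesis mB : is_basis kH (fun j => of_monoid k (m j)).

Definition ker_elt h (hH : act_ker act h) : csub_type kH :=
  CsubElt (kspanU 1 hH : of_monoid k h \in csub_pred kH).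

(** Expand [x] in the basis: some term has a nonzero coefficient at [x], and the support of that
    term lies in [H m_j]. *)
Lemma coset_decomp x : exists h j, act_ker act h /\ x = (h * m j)%g.
Proof.
have [c [xE _]] := mB (of_monoid k x).
have [j cj] : exists j, (val (c 0 j) * of_monoid k (m j))@_x != 0.
  apply: contrapT => none; have /eqP := congr1 (mcoeff x) xE.
  rewrite mcoeffUU raddf_sum big1 ?oner_eq0 // => j _ /=.
  by apply/eqP/negPn/negP => cj; apply: none; exists j.
have [h ch xh] := mcoeff_mulU_neq0 cj; exists h, j; split=> //.
by have /kspanP := csub_valP (c 0 j); apply.
Qed.

Lemma coord_of_monoid h (hH : act_ker act h) j :
  coord mB (of_monoid k (h * m j)%g) = ker_elt hH *: delta_mx 0 j.
Proof. by rewrite -of_monoidM -(coord_delta mB); apply: (coordZ mB (ker_elt hH)). Qed.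

(** The coordinates of [h * m j] are [h] at [j] and zero elsewhere, and [h] is nonzero in [kH]. *)
Lemma coset_inj h h' j j' : act_ker act h -> act_ker act h' ->
  (h * m j)%g = (h' * m j')%g -> j = j'.
Proof.
move=> hH hH' hm; have := coord_of_monoid hH j; rewrite hm (coord_of_monoid hH').
move=> /rowP/(_ j); rewrite !mxE !eqxx mulr1.
case: eqP => // _; rewrite mulr0 => /(congr1 val) /malgP /(_ h).
by rewrite csub_val0 mcoeff0 mcoeffUU => /esym/eqP; rewrite oner_eq0.
Qed.

Lemma reg_tr_of_monoid h (hH : act_ker act h) :
  reg_tr mB (of_monoid k h) = ker_elt hH *+ l.
Proof. exact: (reg_tr_val mB (ker_elt hH)). Qed.

(** A nonzero diagonal entry would require [x * m j = h * m j] with [h] in the kernel, hence [x = h]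
    by cancellation. *)
Lemma reg_tr_of_monoid_notin x : ~ act_ker act x -> reg_tr mB (of_monoid k x) = 0.
Proof.
move=> xH; rewrite /reg_tr /mxtrace big1 // => j _.
have [h [j' [hH xm]]] := coset_decomp (x * m j)%g.
rewrite mxE of_monoidM xm (coord_of_monoid hH) !mxE eqxx /=.
case: eqP => [jj'|_]; last by rewrite mulr0.
by case: xH; rewrite jj' in xm; rewrite (mulM_inj xm).
Qed.

End Cosets.

(** * Bases of [T] over [R] *)

Section TwistedBasis.
Context {k : comNzRingType} {A : algType k} {M : monoidType}.
Context (act : UMagmaMorphism.type M (algAut A)).
Hypothesis mulM_inj : @left_injective M M M (fun x y => (x * y)%g).
Hypothesis HC : forall h x : M, act_ker act h -> commute h x.
Context (R : centralSubalg (twisted act)).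
Local Notation T := (twisted act).
Local Notation kH := (kerAlg HC).
Local Notation B := (capA R).
Hypothesis RE : forall t : T,
  t \in csub_pred R <-> tens_span_of (csub_pred B) (csub_pred kH) t.
Context {l : nat} {m : 'I_l -> M}.
Hypothesis mB : is_basis kH (fun j => of_monoid k (m j)).

(** This and the next lemma put [R = (A cap R) (x) kH] into usable form: as functions on [M],
    elements of [R] take values in [A cap R] and vanish outside [H]. *)
Lemma mcoeff_capA t y : t \in csub_pred R -> t@_y \in csub_pred B.
Proof.
move=> /RE [s sP ->]; rewrite raddf_sum big_seq.
have [_ Blin _] := csub_closed B.
have B0 : 0 \in csub_pred B by rewrite -(csub_val0 B) (csub_valP 0).
elim/big_ind: _ => // [a b aB bB|u /sP [uB _]].
  by rewrite -[a]scale1r; apply: Blin.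
by rewrite /= tensE -[_ *: _]addr0; apply: Blin.
Qed.

Lemma mcoeff_act_ker t y : t \in csub_pred R -> t@_y != 0 -> act_ker act y.
Proof.
move=> /RE [s sP ->]; apply: contraNP => yH; apply/eqP.
rewrite raddf_sum big_seq big1 // => u /sP [_ /kspanP uH] /=.
rewrite tensE; have [->|/uH //] := eqVneq (u.2@_y) 0; exact: scale0r.
Qed.

Lemma embA_capA a : a \in csub_pred B -> embA act a \in csub_pred R.
Proof. by []. Qed.

Lemma embM_kH c : c \in csub_pred kH -> embM act c \in csub_pred R.
Proof.
move=> cH; apply/RE; exists [:: (1, c)]; last by rewrite big_seq1.
move=> u; rewrite inE => /eqP -> /=; split=> //; by have [] := csub_closed B.
Qed.

Definition inA := csub_map embA_capA.
HB.instance Definition _ := GRing.RMorphism.on inA.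
Definition inM := csub_map embM_kH.
HB.instance Definition _ := GRing.RMorphism.on inM.

Lemma val_inAM (a : csub_type B) h (hH : act_ker act h) :
  val (inA a * inM (ker_elt HC hH)) = << val a *g h >>.
Proof.
rewrite csub_valM /= /embM /embA tens_mul tens_of_monoid.
by rewrite mul1g rmorph1 mulr1.
Qed.

Lemma inAM_mulU (a : csub_type B) h (hH : act_ker act h) b x :
  val (inA a * inM (ker_elt HC hH)) * (<< b *g x >> : T) = << val a * b *g (h * x)%g >>.
Proof. by rewrite val_inAM twistedU_mul hH. Qed.

(** As [a (x) 1] is central in [T], it commutes with [1 (x) x]; compare the coefficients at [x]. *)
Lemma act_capA x (a : csub_type B) : act x (val a) = val a.
Proof.
have := csub_central (<< 1 *g x >> : T) (csub_valP (inA a)).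
rewrite /= /embA tens_of_monoid !twistedU_mul mul1g mulg1 rmorph1 mulr1 mul1r.
by move/malgP/(_ x); rewrite !mcoeffUU => /esym.
Qed.

Section Family.
Context {n : nat} {x_ : 'I_l -> 'I_n -> A}.
Hypothesis xB : forall j, is_basis B (x_ j).

(** Each coset may carry its own basis [x_ j] of [A], so that the families [x_i (x) m_j] and
    [(m_j x_i) (x) m_j] are both instances. *)
Definition twisted_basis (p : 'I_(n * l)) : T :=
  << x_ (mxtens_unindex p).2 (mxtens_unindex p).1 *g m (mxtens_unindex p).2 >>.

Lemma twisted_basisE i j : twisted_basis (mxtens_index (i, j)) = << x_ j i *g m j >>.
Proof. by rewrite /twisted_basis mxtens_indexK. Qed.

Definition twisted_coord a h (hH : act_ker act h) j : 'rV[csub_type R]_(n * l) :=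
  \row_p ((inA (coord (xB j) a 0 (mxtens_unindex p).1) * inM (ker_elt HC hH))
           *+ ((mxtens_unindex p).2 == j)).

Lemma twisted_coordE a h (hH : act_ker act h) j :
  << a *g (h * m j)%g >> =
    \sum_p val (twisted_coord a hH j 0 p) * twisted_basis p.
Proof.
rewrite sum_mxtens {1}(coordE (xB j) a) monalgU_sum; apply: eq_bigr => i _.
rewrite (bigD1 j) // big1 => [|j' /negbTE j'j].
  by rewrite [RHS]addr0 mxE twisted_basisE mxtens_indexK eqxx [RHS]inAM_mulU.
by rewrite mxE mxtens_indexK j'j mulr0n csub_val0 mul0r.
Qed.

(** Spanning follows from the coset decomposition. For independence, a relation read at [h * m j]
    involves only the block [j] and becomes a relation between the [x_ j i], whose coefficients are
    the values at [h]. *)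
Lemma twisted_basisP : is_basis R twisted_basis.
Proof.
apply: is_basis_intro => [t|c c0].
  rewrite [t]twistedE; elim/big_ind: _ => [|_ _ [c ->] [d ->]|y _].
  - by exists 0; rewrite big1 // => p _; rewrite mxE csub_val0 mul0r.
  - exists (c + d); rewrite -big_split; apply: eq_bigr => p _.
    by rewrite mxE csub_valD mulrDl.
  have [h [j [hH yE]]] := coset_decomp mB y.
  by exists (twisted_coord (t@_y) hH j); rewrite -twisted_coordE -yE.
apply/rowP => p; case: (mxtens_indexP p) => i j; rewrite [RHS]mxE.
apply: val_inj; rewrite csub_val0; apply/malgP => h; rewrite mcoeff0.
have [hH|hH] := EM (act_ker act h); last first.
  apply/eqP/negPn/negP => /(mcoeff_act_ker (csub_valP _)); exact: hH.
pose b : 'rV[csub_type B]_n :=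
  \row_i CsubElt (mcoeff_capA h (csub_valP (c 0 (mxtens_index (i, j))))).
have b0 : \sum_i val (b 0 i) * x_ j i = 0.
  have := congr1 (mcoeff (h * m j)%g) c0; rewrite mcoeff0 raddf_sum sum_mxtens => s0.
  rewrite -[RHS]s0; apply: eq_bigr => i' _; rewrite (bigD1 j) // big1 => [|j' /eqP j'j].
    by rewrite [RHS]addr0 twisted_basisE [RHS]mcoeff_mulU // hH mxE.
  (* A nonzero contribution from a block [j' <> j] would place [h * m j] in the coset of [m j'] as
     well. *)
  rewrite twisted_basisE; apply/eqP/negPn/negP.
  move=> /mcoeff_mulU_neq0 [h' /(mcoeff_act_ker (csub_valP _)) hH' /esym hm].
  by case: j'j; apply: (coset_inj mB hH' hH hm).
have := coord_uniq (xB j) (esym b0); rewrite (@coord_uniq _ _ _ _ _ (xB j) 0 0).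
  by move=> /rowP/(_ i)/(congr1 val); rewrite !mxE csub_val0.
by rewrite big1 // => i' _; rewrite mxE csub_val0 mul0r.
Qed.

End Family.

(** * Trace of [T] over [R] and its Gram matrix *)

Section Gram.
Context {n : nat} {x : 'I_n -> A}.
Hypothesis xB : is_basis B x.

Let u := @twisted_basis n (fun=> x).
Let uB : is_basis R u := twisted_basisP (fun=> xB).
(* The elements [m_j x_i], as [(1 (x) m)(a (x) 1) = m a (x) m]. *)
Let w := @twisted_basis n (fun j i => act (m j) (x i)).

Lemma twisted_basis_act : is_basis R w.
Proof. by apply: twisted_basisP => j; apply: is_basis_aut => // b; apply: act_capA. Qed.

(** As [h] is central and acts trivially, [a (x) h] preserves each of the [l] blocks and acts there
    as [h] times multiplication by [a]. *)
Lemma reg_tr_twisted a h (hH : act_ker act h) :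
  reg_tr uB << a *g h >> = (inA (reg_tr xB a) * inM (ker_elt HC hH)) *+ l.
Proof.
rewrite /reg_tr /mxtrace sum_mxtens rmorph_sum mulr_suml -sumrMnl.
apply: eq_bigr => i _; rewrite -[l in RHS]card_ord -sumr_const; apply: eq_bigr => j _.
rewrite mxE /u twisted_basisE twistedU_mul hH.
rewrite (coord_uniq uB (twisted_coordE (fun=> xB) (a * x i) hH j)).
by rewrite !mxE mxtens_indexK eqxx.
Qed.

Lemma reg_tr_twisted_notin a y : ~ act_ker act y -> reg_tr uB << a *g y >> = 0.
Proof.
move=> yH; rewrite /reg_tr /mxtrace sum_mxtens.
rewrite big1 // => i _; rewrite big1 // => j _.
rewrite mxE /u twisted_basisE twistedU_mul.
have [h [j' [hH ym]]] := coset_decomp mB (y * m j)%g; rewrite ym.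
rewrite (coord_uniq uB (twisted_coordE (fun=> xB) (a * act y (x i)) hH j')).
rewrite !mxE mxtens_indexK /=; case: eqP => // jj'.
by case: yH; rewrite -jj' in ym; rewrite (mulM_inj ym).
Qed.

(** In [(x_i (x) m_j)(m_t x_s (x) m_t)] the factor [x_s] is acted on by [m_j m_t]. If this product
    lies in [H] the action is trivial, and the factor [l] of the trace is absorbed by
    [tr(m_j m_t) = l m_j m_t]; otherwise both sides vanish. *)
Lemma gram_mx_twisted :
  gram_mx uB u w =
    map_mx inA (gram_mx xB x x) *t
    map_mx inM (gram_mx mB (fun j => of_monoid k (m j)) (fun j => of_monoid k (m j))).
Proof.
apply/matrixP => p q; case: (mxtens_indexP p) => i j; case: (mxtens_indexP q) => s t.
rewrite tensmxE !mxE /u /w !twisted_basisE twistedU_mul of_monoidM.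
rewrite -autME -gmulfM.
have [yH|yH] := EM (act_ker act (m j * m t)%g); last first.
  by rewrite reg_tr_twisted_notin // reg_tr_of_monoid_notin // rmorph0 mulr0.
rewrite yH (reg_tr_twisted _ yH) (reg_tr_of_monoid mB yH) rmorphMn.
by rewrite mulrnAr.
Qed.

Lemma disc_twisted N (z : 'I_N -> T) (zB : is_basis R z) :
  exists c c' : csub_type R, c * c' = 1 /\
    disc zB = c * (inA (disc xB) ^+ l * inM (disc mB) ^+ n).
Proof.
have Nnl := basis_size zB uB; subst N.
have [c [c' [cc' ->]]] := disc_gram zB uB twisted_basis_act.
by exists c, c'; split; rewrite // gram_mx_twisted det_tensmx !det_map_mx.
Qed.

End Gram.
End TwistedBasis.

(** * The discriminant formula for representatives taken in arbitrary bases *)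

Theorem theorem5p1
  (k : closedFieldType) (char0 : [pchar k] =i pred0)
  (A : algType k)
  (G : groupType) (S_M : pred G) (M : subMonoidType S_M)
  (rho : UMagmaMorphism.type G (algAut A))
  (rhoM_Inn : forall s : algAut A,
     (exists x : M, s = rho (val x)) /\ inner s <-> s = 1%g)
  (H_center : forall h x : M, rho (val h) = 1%g -> commute h x)
  (R : centralSubalg (twisted (restrict_act rho M)))
  (n : nat)
  (hyp_a : free_of_rank (capA R) n)
  (hyp_b : forall t : twisted (restrict_act rho M),
     t \in csub_pred R <->
     tens_span_of (csub_pred (capA R)) (csub_pred
        (kerAlg (act := restrict_act rho M) H_center)) t)
  (l : nat) (l_gt0 : (0 < l)%N) (m : 'I_l -> M)
  (m_1 : m (Ordinal l_gt0) = 1%g)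
  (hyp_c : is_basis (kerAlg (act := restrict_act rho M) H_center) (fun i => of_monoid k (m i))) :
  free_of_rank R (n * l) /\
  forall (dT : csub_type R) (dA : csub_type (capA R))
         (dM : csub_type (kerAlg (act := restrict_act rho M) H_center)),
    is_disc dT -> is_disc dA -> is_disc dM ->
    eq_upto_unit R (csub_val dT)
      (embA (restrict_act rho M) (csub_val dA) ^+ l *
       embM (restrict_act rho M) (csub_val dM) ^+ n).
Proof.
(* Right cancellation in [M] is inherited from the group [G]. *)
have mulM_inj : @left_injective M M M (fun x y => (x * y)%g).
  move=> x y z /(congr1 (val : M -> G)); rewrite !valM => /mulIg; exact: val_inj.
split.
  have [x xB] := hyp_a; eexists.
  exact: (twisted_basisP mulM_inj hyp_b hyp_c (fun=> xB)).
move=> dT dA dM [N [z [zB ->]]] [n' [x [xB ->]]] [l' [y [yB ->]]].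
have [x0 x0B] := hyp_a; have nn' := basis_size x0B xB; subst n'.
have [c [c' [cc' ->]]] := disc_twisted mulM_inj hyp_b hyp_c xB zB.
(* The basis [x] giving [dA] already entered the basis of [T], but [y] need not consist of elements
   of [M]; passing from [m] to [y] costs the unit [d], which enters to the power [n]. *)
have [d [d' [dd' ->]]] := disc_indep hyp_c yB.
exists (c * inM hyp_b d ^+ n), (c' * inM hyp_b d' ^+ n); split.
  by rewrite mulrACA cc' mul1r -exprMn -rmorphM dd' rmorph1 expr1n.
have csub_valX (q : csub_type R) i : val (q ^+ i) = val q ^+ i.
  exact: (rmorphXn (val : csub_type R -> _)).
transitivity (val (c * inM hyp_b d ^+ n *
    (inA (disc xB) ^+ l * inM hyp_b (disc yB) ^+ n))).
  by congr val; rewrite rmorphM exprMn mulrACA !mulrA.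
by rewrite csub_valM [val (_ ^+ l * _)]csub_valM !csub_valX.
Qed.
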